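(* Let $\lambda\in\mathbb{R}$ and let $p$ be a positive integer. Then for all real $x$, \[ \sum_{n=1}^{\infty}\Big((1)_{p,\lambda}+(2)_{p,\lambda}+\cdots+(n)_{p,\lambda}\Big)\frac{x^n}{n!}=e^{x}\int_0^x\Big(\phi_{p+1,\lambda}(t)+p\lambda\,\phi_{p,\lambda}(t)\Big)\frac{dt}{t}, \] where the integrand is understood as the polynomial $\sum_{k=1}^{p+1}\big(S_{2,\lambda}(p+1,k)+p\lambda S_{2,\lambda}(p,k)\big)t^{k-1}$ (both $\phi_{p+1,\lambda}$ and $\phi_{p,\lambda}$ vanish at $t=0$).
   Context: For $\lambda\in\mathbb{R}$, the generalized falling factorials are $(x)_{0,\lambda}=1$ and $(x)_{n,\lambda}=x(x-\lambda)(x-2\lambda)\cdots(x-(n-1)\lambda)$ for $n\ge 1$; $(x)_n$ denotes the ordinary falling factorial. The degenerate Stirling numbers of the second kind $S_{2,\lambda}(n,k)$ are defined by $(x)_{n,\lambda}=\sum_{k=0}^{n}S_{2,\lambda}(n,k)(x)_k$, with $S_{2,\lambda}(n,k)=0$ for $k>n$. The degenerate exponential is $e_\lambda(t)=\sum_{n\ge 0}(1)_{n,\lambda}\frac{t^n}{n!}$, and the degenerate Bell polynomials are defined by $e^{x(e_\lambda(t)-1)}=\sum_{n=0}^{\infty}\phi_{n,\lambda}(x)\frac{t^n}{n!}$; equivalently $\phi_{n,\lambda}(x)=\sum_{k=0}^{n}S_{2,\lambda}(n,k)x^k$. *)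

(* Defs.v *)
From Stdlib Require Import Reals Factorial.
From Coquelicot Require Import Coquelicot.
Open Scope R_scope.

Fixpoint gfact (lambda x : R) (n : nat) : R :=
  match n with
  | O => 1
  | S m => gfact lambda x m * (x - INR m * lambda)
  end.

Definition ffact (x : R) (n : nat) : R := gfact 1 x n.

(** The defining expansion determines the array uniquely, since the ordinary
    falling factorials form a basis of the real polynomials. *)
Definition is_dstirling2 (lambda : R) (S2 : nat -> nat -> R) : Prop :=
  (forall (n : nat) (x : R),
     gfact lambda x n = sum_n (fun k => S2 n k * ffact x k) n) /\
  (forall n k : nat, (n < k)%nat -> S2 n k = 0).

(** The power series has a positive radius of convergence (at least
    [1 / Rabs lambda] when [lambda <> 0]), so this is the genuine sum for [t]
    near 0; its values elsewhere are never used. *)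
Definition dexp (lambda t : R) : R :=
  PSeries (fun n => gfact lambda 1 n / INR (fact n)) t.

(** The generating identity is required for all [t] in some neighbourhood of 0,
    which determines every [phi n x] by uniqueness of power series expansions. *)
Definition is_dbell (lambda : R) (phi : nat -> R -> R) : Prop :=
  forall x : R,
    locally 0 (fun t : R =>
      is_pseries (fun n => phi n x / INR (fact n)) t
                 (exp (x * (dexp lambda t - 1)))).

(* Main.v *)
Require Import Defs.
From Stdlib Require Import Reals Factorial Wf_nat Lra Lia.
From Coquelicot Require Import Coquelicot.
Open Scope R_scope.

(** If [M] is Poisson distributed with parameter [x], then the mean of [(M)_k] is [x ^ k],
    so the mean of any function with a finite falling factorial expansion is read off
    its coefficients. Applied to [(M)_{n,lambda}] this gives the Dobinski formula for
    the polynomials [sum_k S2 n k x ^ k]; by the Vandermonde identity for [(m + 1)_{n,lambda}]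
    they satisfy the recurrence obtained by differentiating the generating function
    of the [phi n x], hence agree with them. For the series, the partial sums
    [(1)_{p,lambda} + ... + (n)_{p,lambda}] telescope into falling factorials: if
    [m (m)_{p,lambda} = sum_k c_k (m)_k], then they equal [sum_(k >= 1) (c_k / k) (n)_k],
    whose Poisson mean is the integral of [sum_(k >= 1) c_k t ^ (k - 1)]. *)

(** Turns goals about the algebraic structure operations into equations over [R] that [ring] and
    [field] accept. *)
Ltac to_R :=
  unfold scal, minus, plus, opp, zero; simpl; unfold mult; simpl;
  match goal with |- @eq _ ?a ?b => change (@eq R a b) | _ => idtac end.

(** * Generalized falling factorials *)

Lemma gfact_S_l (lambda x : R) (n : nat) :
  gfact lambda x (S n) = x * gfact lambda (x - lambda) n.
Proof.
  induction n as [|n IH].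
  - simpl; ring.
  - change (gfact lambda x (S (S n)))
      with (gfact lambda x (S n) * (x - INR (S n) * lambda)).
    rewrite IH, S_INR; simpl; ring.
Qed.

Lemma gfact_0 (lambda : R) (n : nat) : (1 <= n)%nat -> gfact lambda 0 n = 0.
Proof.
  intros Hn; destruct n as [|n]; [lia|].
  rewrite gfact_S_l; ring.
Qed.

Lemma ffact_succ (x : R) (k : nat) :
  ffact (x + 1) (S k) = (x + 1) * ffact x k.
Proof.
  unfold ffact; rewrite gfact_S_l.
  replace (x + 1 - 1) with x by ring; reflexivity.
Qed.

(** Discrete analogue of differentiating a power; this makes the partial sums telescope. *)
Lemma ffact_diff (x : R) (k : nat) :
  ffact (x + 1) (S k) - ffact x (S k) = INR (S k) * ffact x k.
Proof.
  rewrite ffact_succ.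
  change (ffact x (S k)) with (ffact x k * (x - INR k * 1)).
  rewrite S_INR; ring.
Qed.

(** The coefficient of [t ^ n] in the [x]-th power of the degenerate exponential; for [lambda = 1],
    the ordinary binomial coefficient. *)
Definition gbinom (lambda x : R) (n : nat) : R := gfact lambda x n / INR (fact n).

Lemma INR_fact_S (n : nat) : INR (fact (S n)) = INR (S n) * INR (fact n).
Proof. rewrite fact_simpl; apply mult_INR. Qed.

Lemma gbinom_S (lambda x : R) (n : nat) :
  INR (S n) * gbinom lambda x (S n) = (x - INR n * lambda) * gbinom lambda x n.
Proof.
  unfold gbinom; rewrite INR_fact_S; simpl gfact.
  field; split; [apply INR_fact_neq_0 | apply not_0_INR; lia].
Qed.

(* Both sides satisfy the recurrence [(n + 1) w (n + 1) = (x + y - n lambda) w n]. *)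
Lemma gbinom_vandermonde (lambda x y : R) (n : nat) :
  gbinom lambda (x + y) n = PS_mult (gbinom lambda x) (gbinom lambda y) n.
Proof.
  induction n as [|n IH].
  - unfold PS_mult, gbinom; simpl; field.
  - apply Rmult_eq_reg_l with (INR (S n)); [|apply not_0_INR; lia].
    rewrite gbinom_S, IH; unfold PS_mult.
    set (a := gbinom lambda x); set (b := gbinom lambda y).
    (* The weight [S n] is split as [k + (S n - k)]. One end term of each sum vanishes, and the
       factors [x - k lambda] and [y - (n - k) lambda] add up to [x + y - n lambda]. *)
    transitivity
      (sum_f_R0 (fun k => INR k * a k * b (S n - k)%nat) (S n)
       + sum_f_R0 (fun k => a k * (INR (S n - k) * b (S n - k)%nat)) (S n)).
    + rewrite (decomp_sum (fun k => INR k * a k * b (S n - k)%nat)) by lia.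
      rewrite (tech5 (fun k => a k * (INR (S n - k) * b (S n - k)%nat))).
      replace (S n - S n)%nat with 0%nat by lia.
      simpl (INR 0); simpl (pred (S n)).
      rewrite !Rmult_0_l, Rmult_0_r, Rplus_0_l, Rplus_0_r.
      rewrite <- sum_plus, scal_sum; apply sum_eq; intros k Hk.
      replace (S n - S k)%nat with (n - k)%nat by lia.
      replace (S n - k)%nat with (S (n - k)) by lia.
      unfold a, b; rewrite !gbinom_S, minus_INR by lia; ring.
    + rewrite <- sum_plus, scal_sum; apply sum_eq; intros k Hk.
      rewrite minus_INR by lia; ring.
Qed.

(** * Poisson means *)

(** The normalising factor is moved to the right as [exp x], convergence is part of the relation,
    and [x] may have any sign. *)
Definition poisson_mean (x : R) (g : nat -> R) (v : R) : Prop :=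
  is_series (fun m => g m * (x ^ m / INR (fact m))) (exp x * v).

Lemma poisson_mean_ext (x : R) (g h : nat -> R) (v : R) :
  (forall m, g m = h m) -> poisson_mean x g v -> poisson_mean x h v.
Proof.
  intros E; apply is_series_ext; intros m; rewrite E; reflexivity.
Qed.

Lemma poisson_mean_plus (x : R) (g h : nat -> R) (v w : R) :
  poisson_mean x g v -> poisson_mean x h w ->
  poisson_mean x (fun m => g m + h m) (v + w).
Proof.
  intros Hg Hh; unfold poisson_mean; rewrite Rmult_plus_distr_l.
  eapply is_series_ext; [|exact (is_series_plus _ _ _ _ Hg Hh)].
  intros m; to_R; ring.
Qed.

Lemma poisson_mean_scal (x c : R) (g : nat -> R) (v : R) :
  poisson_mean x g v -> poisson_mean x (fun m => c * g m) (c * v).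
Proof.
  intros Hg; unfold poisson_mean.
  replace (exp x * (c * v)) with (scal c (exp x * v)) by (to_R; ring).
  eapply is_series_ext; [|exact (is_series_scal c _ _ Hg)].
  intros m; to_R; ring.
Qed.

Lemma poisson_mean_sum (x : R) (g : nat -> nat -> R) (v : nat -> R) (n : nat) :
  (forall k, (k <= n)%nat -> poisson_mean x (g k) (v k)) ->
  poisson_mean x (fun m => sum_f_R0 (fun k => g k m) n) (sum_f_R0 v n).
Proof.
  induction n as [|n IH]; intros H; simpl.
  - apply H; lia.
  - apply poisson_mean_plus; [apply IH; intros k Hk|]; apply H; lia.
Qed.

(** For [m >= 1], [m x ^ m / m! = x x ^ (m - 1) / (m - 1)!], while the term at [m = 0] vanishes. *)
Lemma poisson_mean_shift (x : R) (g : nat -> R) (v : R) :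
  poisson_mean x (fun m => g (S m)) v ->
  poisson_mean x (fun m => INR m * g m) (x * v).
Proof.
  intros H; unfold poisson_mean; apply is_series_decr_1.
  replace (plus _ _) with (scal x (exp x * v))
    by (to_R; field).
  eapply is_series_ext; [|exact (is_series_scal x _ _ H)].
  intros m; rewrite INR_fact_S.
  change (x * (g (S m) * (x ^ m / INR (fact m)))
          = INR (S m) * g (S m) * (x * x ^ m / (INR (S m) * INR (fact m)))).
  field; split; [apply INR_fact_neq_0 | apply not_0_INR; lia].
Qed.

Lemma poisson_mean_unique (x : R) (g : nat -> R) (v w : R) :
  poisson_mean x g v -> poisson_mean x g w -> v = w.
Proof.
  intros Hv Hw; apply is_series_unique in Hv; apply is_series_unique in Hw.
  apply Rmult_eq_reg_l with (exp x); [congruence|].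
  apply Rgt_not_eq, exp_pos.
Qed.

(** Induction through [(m)_(k + 1) = m (m - 1)_k] and the shift rule, starting from the exponential
    series. *)
Lemma poisson_mean_ffact (x : R) (k : nat) :
  poisson_mean x (fun m => ffact (INR m) k) (x ^ k).
Proof.
  induction k as [|k IH].
  - unfold poisson_mean; simpl pow; rewrite Rmult_1_r.
    eapply is_series_ext; [|exact (proj1 (is_pseries_R _ _ _) (is_exp_Reals x))].
    intros m; unfold ffact; simpl.
    field; apply INR_fact_neq_0.
  - apply poisson_mean_ext with (fun m => INR m * ffact (INR m - 1) k).
    + intros m; unfold ffact; rewrite gfact_S_l; reflexivity.
    + apply (poisson_mean_shift x (fun m => ffact (INR m - 1) k)).
      apply poisson_mean_ext with (2 := IH); intros m.
      rewrite S_INR; f_equal; ring.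
Qed.

Lemma poisson_mean_ffact_sum (x : R) (c : nat -> R) (n : nat) :
  poisson_mean x (fun m => sum_f_R0 (fun k => c k * ffact (INR m) k) n)
    (sum_f_R0 (fun k => c k * x ^ k) n).
Proof.
  apply (poisson_mean_sum x (fun k m => c k * ffact (INR m) k)); intros k _.
  apply (poisson_mean_scal x (c k) (fun m => ffact (INR m) k)).
  apply poisson_mean_ffact.
Qed.

Lemma is_RInt_power_sum (c : nat -> R) (n : nat) (x : R) :
  is_RInt (fun t => sum_f_R0 (fun j => c j * t ^ j) n) 0 x
    (sum_f_R0 (fun j => c j / INR (S j) * x ^ S j) n).
Proof.
  induction n as [|n IH].
  - simpl.
    replace (c 0%nat / 1 * (x * 1)) with (scal (x - 0) (c 0%nat * 1))
      by (to_R; field).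
    apply (@is_RInt_const R_NormedModule).
  - apply (@is_RInt_plus R_NormedModule _ _ _ _ _ _ IH).
    set (F := fun t => c (S n) / INR (S (S n)) * t ^ S (S n)).
    replace (c (S n) / INR (S (S n)) * x ^ S (S n)) with (minus (F x) (F 0)).
    + apply (@is_RInt_derive R_CompleteNormedModule F).
      * intros t _; unfold F; evar_last.
        -- apply is_derive_scal, is_derive_pow, is_derive_id.
        -- change (c (S n) / INR (S (S n)) * (INR (S (S n)) * 1 * t ^ S n) = c (S n) * t ^ S n).
           field; apply not_0_INR; lia.
      * intros t _; apply (ex_derive_continuous (V := R_NormedModule)); auto_derive; trivial.
    + unfold F, minus, plus, opp; simpl; field.
      change (INR (S (S n)) <> 0); apply not_0_INR; lia.
Qed.

(** * Power series near the origin *)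

(** The series converges at the nonzero point [e / 2], whereas beyond the radius its terms would not
    tend to 0. *)
Lemma CV_radius_gt_0_of_locally (a : nat -> R) (f : R -> R) :
  locally 0 (fun t => is_pseries a t (f t)) -> Rbar_lt 0 (CV_radius a).
Proof.
  intros [e He].
  apply Rbar_lt_le_trans with (Rabs (e / 2)).
  - simpl; apply Rabs_pos_lt; destruct e; simpl; lra.
  - apply Rbar_not_lt_le; intros H; apply CV_disk_outside in H; apply H.
    apply ex_series_lim_0; exists (f (e / 2)); apply is_pseries_R, He.
    unfold ball; simpl; unfold AbsRing_ball, abs, minus, plus, opp; simpl.
    destruct e as [e He0]; simpl in *.
    rewrite Rabs_pos_eq; lra.
Qed.

Lemma locally_CV_radius (a : nat -> R) :
  Rbar_lt 0 (CV_radius a) ->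
  locally 0 (fun t => Rbar_lt (Rabs t) (CV_radius a)).
Proof.
  intros H.
  assert (He : exists e : posreal, Rbar_le e (CV_radius a)).
  { destruct (CV_radius a) as [r| |]; simpl in H.
    - exists (mkposreal r H); simpl; lra.
    - exists (mkposreal 1 Rlt_0_1); exact I.
    - destruct H. }
  destruct He as [e He]; exists e; intros t Ht.
  apply Rbar_lt_le_trans with e; [|exact He].
  unfold ball in Ht; simpl in Ht; unfold AbsRing_ball, abs, minus, plus, opp in Ht.
  simpl in Ht |- *; replace t with (t + - 0) by ring; exact Ht.
Qed.

Lemma is_pseries_locally_unique (a b : nat -> R) (f : R -> R) :
  locally 0 (fun t => is_pseries a t (f t)) ->
  locally 0 (fun t => is_pseries b t (f t)) ->
  forall n, a n = b n.
Proof.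
  intros Ha Hb n; apply PSeries_ext_recip.
  - exact (CV_radius_gt_0_of_locally _ _ Ha).
  - exact (CV_radius_gt_0_of_locally _ _ Hb).
  - generalize (filter_and _ _ Ha Hb); apply filter_imp; intros t [H1 H2].
    apply is_pseries_unique in H1; apply is_pseries_unique in H2; congruence.
Qed.

Lemma is_pseries_at_0 (a : nat -> R) (l : R) : is_pseries a 0 l -> l = a 0%nat.
Proof.
  intros H; apply is_pseries_unique in H; rewrite <- H; apply PSeries_0.
Qed.

(** By [gbinom_S], since [|1 - n lambda| <= (n + 1) (1 + |lambda|)]. *)
Lemma gbinom_1_bound (lambda : R) (n : nat) :
  Rabs (gbinom lambda 1 n) <= (1 + Rabs lambda) ^ n.
Proof.
  pose proof (Rabs_pos lambda) as HL.
  induction n as [|n IH].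
  - unfold gbinom; simpl; rewrite Rdiv_1_r, Rabs_R1; lra.
  - assert (Hn : 0 < INR (S n)) by (apply lt_0_INR; lia).
    pose proof (pos_INR n) as Hn0.
    apply Rmult_le_reg_l with (INR (S n)); [exact Hn|].
    rewrite <- (Rabs_pos_eq (INR (S n))) at 1 by lra.
    rewrite <- Rabs_mult, gbinom_S, Rabs_mult.
    replace (INR (S n) * (1 + Rabs lambda) ^ S n)
      with (INR (S n) * (1 + Rabs lambda) * (1 + Rabs lambda) ^ n) by (simpl; ring).
    apply Rmult_le_compat; try apply Rabs_pos; [|exact IH].
    eapply Rle_trans; [apply Rabs_triang|].
    rewrite Rabs_R1, Rabs_Ropp, Rabs_mult, (Rabs_pos_eq (INR n)) by lra.
    rewrite S_INR; nra.
Qed.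

Lemma CV_radius_gbinom_1 (lambda : R) : Rbar_lt 0 (CV_radius (gbinom lambda 1)).
Proof.
  pose proof (Rabs_pos lambda) as HL.
  apply Rbar_lt_le_trans with (/ (1 + Rabs lambda)).
  - simpl; apply Rinv_0_lt_compat; lra.
  - apply CV_radius_bounded; exists 1; intros n.
    rewrite Rabs_mult, <- RPow_abs, Rabs_inv, (Rabs_pos_eq (1 + _)) by lra.
    rewrite pow_inv.
    apply Rmult_le_reg_r with ((1 + Rabs lambda) ^ n); [apply pow_lt; lra|].
    rewrite Rmult_assoc, Rinv_l by (apply pow_nonzero; lra).
    rewrite Rmult_1_r, Rmult_1_l; apply gbinom_1_bound.
Qed.

(** * The degenerate exponential and the degenerate Bell polynomials *)

Lemma dexp_pseries (lambda : R) :
  locally 0 (fun t => is_pseries (gbinom lambda 1) t (dexp lambda t)).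
Proof.
  generalize (locally_CV_radius _ (CV_radius_gbinom_1 lambda)).
  apply filter_imp; intros t Ht; apply PSeries_correct, CV_radius_inside, Ht.
Qed.

(* The coefficients of [(1 + lambda t) a'(t)]. *)
Definition twisted_derive (lambda : R) (a : nat -> R) : nat -> R :=
  PS_plus (PS_derive a) (PS_scal lambda (PS_incr_1 (PS_derive a))).

Lemma twisted_derive_coeff (lambda : R) (a : nat -> R) (n : nat) :
  twisted_derive lambda a n = INR (S n) * a (S n) + lambda * (INR n * a n).
Proof.
  unfold twisted_derive, PS_plus, PS_scal, PS_incr_1, PS_derive.
  destruct n; to_R; ring.
Qed.

Lemma twisted_derive_pseries (lambda : R) (a : nat -> R) (t : R) :
  Rbar_lt (Rabs t) (CV_radius a) ->
  is_pseries (twisted_derive lambda a) t ((1 + lambda * t) * Derive (PSeries a) t).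
Proof.
  intros Ht; pose proof (is_pseries_derive a t Ht) as Hd.
  replace ((1 + lambda * t) * Derive (PSeries a) t)
    with (plus (Derive (PSeries a) t) (scal lambda (scal t (Derive (PSeries a) t))))
    by (to_R; ring).
  apply (@is_pseries_plus R_AbsRing R_NormedModule); [exact Hd|].
  apply (@is_pseries_scal R_AbsRing R_NormedModule); [apply Rmult_comm|].
  apply (@is_pseries_incr_1 R_AbsRing R_NormedModule _ t _), Hd.
Qed.

(** At [x = 1], [gbinom_S] says that [twisted_derive] fixes the coefficient sequence of [dexp]. *)
Lemma dexp_ode (lambda : R) :
  locally 0 (fun t => is_derive (dexp lambda) t (Derive (dexp lambda) t) /\
                      (1 + lambda * t) * Derive (dexp lambda) t = dexp lambda t).
Proof.
  generalize (locally_CV_radius _ (CV_radius_gbinom_1 lambda)).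
  apply filter_imp; intros t Ht; split.
  - apply Derive_correct, (ex_derive_PSeries _ _ Ht).
  - pose proof (twisted_derive_pseries lambda _ _ Ht) as H.
    apply is_pseries_unique in H.
    change (dexp lambda) with (PSeries (gbinom lambda 1)); rewrite <- H.
    apply PSeries_ext; intros n.
    rewrite twisted_derive_coeff, gbinom_S; ring.
Qed.

(* Differentiate [f(t) = exp (x (dexp t - 1))] and use [(1 + lambda t) dexp' = dexp]
   to get [(1 + lambda t) f' = x dexp f]; then compare coefficients. *)
Lemma exp_dexp_coeff (lambda x : R) (b : nat -> R) :
  locally 0 (fun t => is_pseries b t (exp (x * (dexp lambda t - 1)))) ->
  forall n, INR (S n) * b (S n) + lambda * (INR n * b n)
            = x * PS_mult (gbinom lambda 1) b n.
Proof.
  intros Hb n.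
  pose proof (CV_radius_gt_0_of_locally _ _ Hb) as Hr.
  rewrite <- twisted_derive_coeff.
  change (x * PS_mult (gbinom lambda 1) b n)
    with (PS_scal x (PS_mult (gbinom lambda 1) b) n).
  revert n; apply is_pseries_locally_unique
    with (f := fun t => (1 + lambda * t) * Derive (PSeries b) t).
  - generalize (locally_CV_radius _ Hr); apply filter_imp; intros t.
    apply twisted_derive_pseries.
  - generalize (filter_and _ _ (filter_and _ _ (locally_locally _ _ Hb) (dexp_ode lambda))
      (filter_and _ _ (dexp_pseries lambda)
        (filter_and _ _ (locally_CV_radius _ Hr)
          (locally_CV_radius _ (CV_radius_gbinom_1 lambda))))).
    apply filter_imp; intros t [[Hloc [Hd Hode]] [He [Htb Hta]]].
    (* The series equals the exponential on a whole neighbourhood of [t], so the derivatives agree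
       and the chain rule applies. *)
    assert (HD : Derive (PSeries b) t
                 = x * Derive (dexp lambda) t * exp (x * (dexp lambda t - 1))).
    { rewrite (Derive_ext_loc _ (fun t => exp (x * (dexp lambda t - 1)))).
      - apply is_derive_unique; auto_derive.
        + exists (Derive (dexp lambda) t); exact Hd.
        + change (Derive (fun x0 => dexp lambda x0) t) with (Derive (dexp lambda) t); unfold Rminus; ring.
      - revert Hloc; apply filter_imp; intros u; apply is_pseries_unique. }
    replace ((1 + lambda * t) * Derive (PSeries b) t)
      with (scal x (dexp lambda t * exp (x * (dexp lambda t - 1)))).
    + apply (@is_pseries_scal R_AbsRing R_NormedModule); [apply Rmult_comm|].
      apply is_pseries_mult; auto.
      exact (locally_singleton _ _ Hloc).
    + rewrite HD.
      transitivity (x * ((1 + lambda * t) * Derive (dexp lambda) t)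
                    * exp (x * (dexp lambda t - 1))); [rewrite Hode|]; to_R; ring.
Qed.

Lemma exp_dexp_coeff_0 (lambda x : R) (b : nat -> R) :
  locally 0 (fun t => is_pseries b t (exp (x * (dexp lambda t - 1)))) ->
  b 0%nat = 1.
Proof.
  intros Hb; apply locally_singleton, is_pseries_at_0 in Hb.
  pose proof (locally_singleton _ _ (dexp_pseries lambda)) as He.
  apply is_pseries_at_0 in He.
  rewrite <- Hb, He; unfold gbinom; simpl.
  replace (x * (1 / 1 - 1)) with 0 by field; apply exp_0.
Qed.

(** * Dobinski formula and falling factorial expansions *)

Section Stirling.

Variables (lambda : R) (S2 : nat -> nat -> R).
Hypothesis HS2 : is_dstirling2 lambda S2.

Let bell (n : nat) (x : R) : R := sum_f_R0 (fun k => S2 n k * x ^ k) n.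

Lemma gfact_dstirling2 (n : nat) (x : R) :
  gfact lambda x n = sum_f_R0 (fun k => S2 n k * ffact x k) n.
Proof. rewrite (proj1 HS2), sum_n_Reals; reflexivity. Qed.

Lemma dobinski (n : nat) (x : R) :
  poisson_mean x (fun m => gfact lambda (INR m) n) (bell n x).
Proof.
  eapply poisson_mean_ext; [|apply (poisson_mean_ffact_sum x (S2 n) n)].
  intros m; symmetry; apply gfact_dstirling2.
Qed.

Lemma dobinski_gbinom (n : nat) (x : R) :
  poisson_mean x (fun m => gbinom lambda (INR m) n) (bell n x / INR (fact n)).
Proof.
  replace (bell n x / INR (fact n)) with (/ INR (fact n) * bell n x) by apply Rmult_comm.
  eapply poisson_mean_ext; [|apply poisson_mean_scal, dobinski].
  intros m; apply Rmult_comm.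
Qed.

(** Both sides are the Poisson mean of [m * gbinom lambda m n]: the left by [gbinom_S], the right by
    the shift rule and Vandermonde for [m + 1]. *)
Lemma bell_recurrence (n : nat) (x : R) :
  let b k := bell k x / INR (fact k) in
  INR (S n) * b (S n) + lambda * (INR n * b n) = x * PS_mult (gbinom lambda 1) b n.
Proof.
  intros b; apply poisson_mean_unique with x (fun m => INR m * gbinom lambda (INR m) n).
  - eapply poisson_mean_ext;
      [|apply poisson_mean_plus;
        [apply poisson_mean_scal, dobinski_gbinom
        |apply poisson_mean_scal, poisson_mean_scal, dobinski_gbinom]].
    intros m; cbv beta; rewrite gbinom_S; ring.
  - apply (poisson_mean_shift x (fun m => gbinom lambda (INR m) n)).
    eapply poisson_mean_ext;
      [|apply (poisson_mean_sum x
          (fun k m => gbinom lambda 1 k * gbinom lambda (INR m) (n - k)%nat))].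
    + intros m; rewrite S_INR, Rplus_comm, gbinom_vandermonde; reflexivity.
    + intros k _; apply (poisson_mean_scal x _ (fun m => gbinom lambda (INR m) (n - k)%nat)).
      apply dobinski_gbinom.
Qed.

Lemma dbell_eq (phi : nat -> R -> R) (n : nat) (x : R) :
  is_dbell lambda phi -> phi n x = bell n x.
Proof.
  intros Hphi.
  set (b := fun k => phi k x / INR (fact k)).
  set (c := fun k => bell k x / INR (fact k)).
  enough (H : b n = c n).
  { apply Rmult_eq_reg_r with (/ INR (fact n)); [exact H|].
    apply Rinv_neq_0_compat, INR_fact_neq_0. }
  (* Strong induction, because the convolution at [n] involves all values up to [n]. *)
  induction n as [n IH] using lt_wf_ind; destruct n as [|n].
  - unfold b; rewrite (exp_dexp_coeff_0 lambda x _ (Hphi x)).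
    (* This instance reads [S2 0 0 = 1]. *)
    pose proof (gfact_dstirling2 0 0) as H; unfold ffact in H; simpl in H.
    unfold c, bell; simpl; rewrite <- H; field.
  - pose proof (exp_dexp_coeff lambda x _ (Hphi x) n) as Hb.
    pose proof (bell_recurrence n x) as Hc; cbv zeta in Hc.
    fold b in Hb; fold c in Hc; rewrite (IH n) in Hb by lia.
    assert (E : PS_mult (gbinom lambda 1) b n = PS_mult (gbinom lambda 1) c n).
    { apply sum_eq; intros k Hk; rewrite IH by lia; reflexivity. }
    rewrite E, <- Hc in Hb.
    apply Rmult_eq_reg_l with (INR (S n)); [|apply not_0_INR; lia].
    apply Rplus_eq_reg_r with (1 := Hb).
Qed.

(** Evaluation of the defining expansion at 0, where only the constant term survives. *)
Lemma dstirling2_0 (n : nat) : (1 <= n)%nat -> S2 n 0 = 0.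
Proof.
  intros Hn; rewrite <- (gfact_0 lambda n Hn), gfact_dstirling2.
  destruct n as [|n]; [lia|].
  rewrite decomp_sum by lia; simpl pred.
  rewrite (sum_eq _ (fun _ => 0)), sum_cte.
  - unfold ffact; simpl; ring.
  - intros k _; unfold ffact; rewrite gfact_0 by lia; ring.
Qed.

(* The coefficients of [x (x)_{p,lambda} = (x)_{p+1,lambda} + p lambda (x)_{p,lambda}]
   on [(x)_(j+1)]. *)
Let d (p j : nat) : R := S2 (S p) (S j) + INR p * lambda * S2 p (S j).

(** The sequence [u] is arbitrary so as to cover both falling factorials and powers of [t]. The
    terms at [k = 0] vanish because [p >= 1]. *)
Lemma dstirling2_sum_shift (p : nat) (u : nat -> R) : (1 <= p)%nat ->
  sum_f_R0 (fun k => S2 (S p) k * u k) (S p)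
  + INR p * lambda * sum_f_R0 (fun k => S2 p k * u k) p
  = sum_f_R0 (fun j => d p j * u (S j)) p.
Proof.
  intros Hp.
  assert (E : sum_f_R0 (fun k => S2 p k * u k) p
              = sum_f_R0 (fun k => S2 p k * u k) (S p)).
  { rewrite tech5, (proj2 HS2 p (S p)) by lia; ring. }
  rewrite E, !(decomp_sum _ (S p)) by lia; simpl pred.
  rewrite !dstirling2_0 by lia.
  rewrite !Rmult_0_l, !Rplus_0_l, scal_sum, <- sum_plus.
  apply sum_eq; intros j _; unfold d; ring.
Qed.

(** The expansion of [x (x)_{p,lambda}] at [x = n + 1], divided by [n + 1] using
    [(n + 1)_(j + 1) = (n + 1) (n)_j]. *)
Lemma gfact_succ_expansion (p n : nat) : (1 <= p)%nat ->
  gfact lambda (INR n + 1) p = sum_f_R0 (fun j => d p j * ffact (INR n) j) p.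
Proof.
  intros Hp; pose proof (pos_INR n) as Hn.
  pose proof (dstirling2_sum_shift p (ffact (INR n + 1)) Hp) as H.
  rewrite <- !gfact_dstirling2 in H; simpl gfact in H.
  apply Rmult_eq_reg_l with (INR n + 1); [|lra].
  transitivity (sum_f_R0 (fun j => d p j * ffact (INR n + 1) (S j)) p).
  - rewrite <- H; ring.
  - rewrite scal_sum; apply sum_eq; intros j _; rewrite ffact_succ; ring.
Qed.

Lemma gfact_partial_sums (p n : nat) : (1 <= p)%nat ->
  sum_n_m (fun k => gfact lambda (INR k) p) 1 n
  = sum_f_R0 (fun j => d p j / INR (S j) * ffact (INR n) (S j)) p.
Proof.
  intros Hp; induction n as [|n IH].
  - rewrite sum_n_m_zero by lia.
    rewrite (sum_eq _ (fun _ => 0)), sum_cte; [to_R; ring|].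
    intros j _; unfold ffact; rewrite gfact_0 by lia; ring.
  - rewrite sum_n_Sm, IH by lia; change (@plus R_AbelianMonoid ?a ?b) with (a + b).
    rewrite (S_INR n), gfact_succ_expansion by exact Hp.
    rewrite <- sum_plus; apply sum_eq; intros j _.
    (* The increment [(j + 1) (n)_j] cancels the denominator and leaves the expansion of the new
       summand. *)
    replace (ffact (INR n + 1) (S j))
      with (ffact (INR n) (S j) + INR (S j) * ffact (INR n) j)
      by (rewrite <- ffact_diff; ring).
    field; apply not_0_INR; lia.
Qed.

End Stirling.

(** * Exponential generating series of the partial sums *)

Theorem theorem7 (lambda : R) (S2 : nat -> nat -> R) (phi : nat -> R -> R)
    (HS2 : is_dstirling2 lambda S2) (Hphi : is_dbell lambda phi)
    (p : nat) (Hp : (1 <= p)%nat) :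
  let integrand (t : R) : R :=
    sum_n_m (fun k => (S2 (p + 1)%nat k + INR p * lambda * S2 p k)
                      * t ^ (k - 1)) 1 (p + 1) in
  (phi (p + 1)%nat 0 = 0 /\ phi p 0 = 0) /\
  (forall t : R, t <> 0 ->
     (phi (p + 1)%nat t + INR p * lambda * phi p t) / t = integrand t) /\
  (forall x : R,
     is_series
       (fun n : nat =>
          sum_n_m (fun k => gfact lambda (INR k) p) 1 (n + 1)
          * (x ^ (n + 1) / INR (fact (n + 1))))
       (exp x * RInt integrand 0 x)).
Proof.
  intros integrand.
  set (d := fun j => S2 (S p) (S j) + INR p * lambda * S2 p (S j)).
  assert (Hint : forall t, integrand t = sum_f_R0 (fun j => d j * t ^ j) p).
  { intros t; unfold integrand; rewrite !Nat.add_1_r, <- sum_n_m_S, <- sum_n_Reals.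
    apply sum_n_ext; intros j; unfold d; simpl (S j - 1)%nat.
    rewrite Nat.sub_0_r; reflexivity. }
  assert (Hphi0 : forall n, (1 <= n)%nat -> phi n 0 = 0).
  { intros n Hn; rewrite (dbell_eq lambda S2 HS2 phi n 0 Hphi).
    destruct n as [|n]; [lia|].
    rewrite decomp_sum, (dstirling2_0 lambda S2 HS2) by lia; simpl pred.
    rewrite (sum_eq _ (fun _ => 0)), sum_cte; [ring|].
    intros k _; simpl; ring. }
  rewrite Nat.add_1_r; repeat split.
  - apply Hphi0; lia.
  - apply Hphi0, Hp.
  - intros t Ht.
    rewrite Hint, !(dbell_eq lambda S2 HS2 phi _ t Hphi).
    rewrite (dstirling2_sum_shift lambda S2 HS2 p (fun k => t ^ k) Hp).
    apply Rmult_eq_reg_l with t; [|exact Ht].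
    rewrite scal_sum; unfold Rdiv; rewrite Rmult_comm, Rmult_assoc, Rinv_l, Rmult_1_r by exact Ht.
    apply sum_eq; intros j _; unfold d; simpl; ring.
  - intros x.
    rewrite (RInt_ext _ (fun t => sum_f_R0 (fun j => d j * t ^ j) p)) by (intros t _; apply Hint).
    rewrite (is_RInt_unique _ _ _ _ (is_RInt_power_sum d p x)).
    set (V := sum_f_R0 _ p).
    assert (H : poisson_mean x (fun n => sum_n_m (fun k => gfact lambda (INR k) p) 1 n) V).
    { eapply poisson_mean_ext;
        [|apply (poisson_mean_sum x (fun j n => d j / INR (S j) * ffact (INR n) (S j)))].
      - intros n; symmetry; apply (gfact_partial_sums lambda S2 HS2 p n Hp).
      - intros j _; apply (poisson_mean_scal x _ (fun n => ffact (INR n) (S j))).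
        apply poisson_mean_ffact. }
    set (G := fun n => sum_n_m (fun k => gfact lambda (INR k) p) 1 n * (x ^ n / INR (fact n))).
    (* The series starts at index 1, the Poisson mean at index 0, where the empty sum contributes
       0. *)
    apply is_series_ext with (fun n => G (S n)).
    + intros n; rewrite Nat.add_1_r; reflexivity.
    + apply is_series_incr_1.
      unfold G at 2; rewrite sum_n_m_zero by lia.
      match goal with |- is_series _ ?l => replace l with (exp x * V) by (to_R; ring) end.
      exact H.
Qed.
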